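(* Let $(\mathcal{X},\mathcal{B})$ be any Steiner system $S(t,k,n)$ with point set $\mathcal{X}=[0,n-1]$. Then its min-sum satisfies $$\min_{B\in\mathcal{B}}\ \sum_{x\in B}x\ \le\ \frac{n(k-t+1)+k(t-2)}{2}.$$
   Context: For integers $a\le b$, $[a,b]=\{a,a+1,\ldots,b\}$. A Steiner system $S(t,k,n)$ (a $t$-$(n,k,1)$ design), where $1\le t\le k\le n$ are integers, is a pair $(\mathcal{X},\mathcal{B})$ where $\mathcal{X}$ is an $n$-set of points and $\mathcal{B}$ is a collection of $k$-subsets of $\mathcal{X}$ (blocks) such that every $t$-subset of $\mathcal{X}$ is contained in exactly one block. Here the points are the integers $0,\ldots,n-1$. The min-sum of the design is the minimum over blocks $B\in\mathcal{B}$ of the block-sum $\sum_{x\in B}x$. *)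

(* Defs.v *)
From HB Require Import structures.
From mathcomp Require Import all_boot all_order all_algebra.

Set Implicit Arguments.
Unset Strict Implicit.
Unset Printing Implicit Defensive.

Record steiner_system (t k n : nat) (X : finType) (Bs : {set {set X}}) : Prop :=
  SteinerSystem {
    steiner_params : [/\ 1 <= t, t <= k & k <= n];
    steiner_points : #|X| = n;
    steiner_blocks : forall B : {set X}, B \in Bs -> #|B| = k;
    steiner_cover : forall T : {set X}, #|T| = t ->
      exists! B : {set X}, B \in Bs /\ T \subset B
  }.

Definition block_sum (n : nat) (B : {set 'I_n}) : nat := \sum_(x in B) (x : nat).

(* The default value is the sum of all the points: it is an upper bound of
   every block sum, so it does not affect the minimum of a nonempty family
   (see min_sum_le and min_sum_attained). *)
Definition min_sum (n : nat) (Bs : {set {set 'I_n}}) : nat :=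
  \big[minn/block_sum [set: 'I_n]]_(B in Bs) block_sum B.

Lemma block_sum_leT (n : nat) (B : {set 'I_n}) :
  block_sum B <= block_sum [set: 'I_n].
Proof.
rewrite /block_sum [X in _ <= X](bigID (mem B)) /=.
by under [X in _ <= X + _]eq_bigl => x do rewrite inE; exact: leq_addr.
Qed.

Lemma min_sum_le (n : nat) (Bs : {set {set 'I_n}}) (B : {set 'I_n}) :
  B \in Bs -> min_sum Bs <= block_sum B.
Proof.
move=> BBs; rewrite /min_sum; have := mem_index_enum B.
elim: (index_enum _) => //= C s IHs; rewrite big_cons inE => /orP[/eqP <-|/IHs].
  by rewrite BBs geq_minl.
by case: ifP => // _; apply: leq_trans (geq_minr _ _).
Qed.

Lemma min_sum_attained (n : nat) (Bs : {set {set 'I_n}}) :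
  Bs != set0 -> exists2 B, B \in Bs & min_sum Bs = block_sum B.
Proof.
case/set0Pn => B0 B0Bs.
suff [E|//] : min_sum Bs = block_sum [set: 'I_n] \/
    exists2 B, B \in Bs & min_sum Bs = block_sum B.
  exists B0 => //; apply/eqP; rewrite eqn_leq min_sum_le //=.
  by rewrite E block_sum_leT.
rewrite /min_sum; elim/big_ind: _ => [|m p Hm Hp|B BBs]; first by left.
  by rewrite /minn; case: ifP.
by right; exists B.
Qed.

Lemma steiner_blocks_neq0 (t k n : nat) (X : finType) (Bs : {set {set X}}) :
  steiner_system t k n Bs -> Bs != set0.
Proof.
case=> -[_ tk kn] cardX _ cov.
have tX : t <= #|[set: X]| by rewrite cardsT cardX (leq_trans tk).
have /card_gt0P[T] : 0 < #|[set A : {set X} | #|A| == t]|.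
  by rewrite card_draws bin_gt0 -cardsT.
rewrite inE => /eqP /cov[B [[BBs _] _]].
by apply/set0Pn; exists B.
Qed.

(* Main.v *)
(** The blocks containing a fixed [(t - 1)]-set [R] partition the remaining
    points into classes of size [k - t + 1].  For [R = {0, ..., t - 2}], the
    average sum of these blocks is exactly the claimed bound. *)

Require Import Defs.
From mathcomp Require Import all_boot all_order all_algebra.
From mathcomp Require Import ring lra.

Set Implicit Arguments.
Unset Strict Implicit.
Unset Printing Implicit Defensive.

Import Order.TTheory GRing.Theory Num.Theory.

(** For [x] outside [R], the set [x |: R] has [t] elements, so exactly one block contains both [R]
    and [x]. After exchanging the sums, each [f x] is therefore counted once. *)
Lemma sum_derived_blocks (t k n : nat) (X : finType) (Bs : {set {set X}})
    (R : {set X}) (f : X -> nat) :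
  steiner_system t k n Bs -> #|R| = t.-1 ->
  \sum_(B in Bs | R \subset B) \sum_(x in B :\: R) f x = \sum_(x in ~: R) f x.
Proof.
move=> [[t1 _ _] _ _ cov] cardR.
rewrite (exchange_big_dep (mem (~: R))) /=; last first.
  by move=> B x _; rewrite !inE => /andP[].
apply: eq_bigr => x; rewrite inE => xR.
have [|B [[BBs]]] := cov (x |: R); first by rewrite cardsU1 xR cardR add1n prednK.
rewrite subUset sub1set => /andP[xB RB] Buniq.
rewrite (big_pred1 B) // => C; rewrite !inE xR /=.
apply/idP/eqP => [/andP[/andP[CBs RC] xC]|->]; last by rewrite BBs RB xB.
by apply/esym/Buniq; split=> //; rewrite subUset sub1set xC.
Qed.

Lemma double_sum_nat (n : nat) : 2 * \sum_(0 <= i < n) i + n = n ^ 2.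
Proof.
elim: n => [|n IHn]; first by rewrite big_geq.
by rewrite big_nat_recr //= mulnDr -(addn1 n) sqrnD -IHn; ring.
Qed.

Local Open Scope ring_scope.

Theorem proposition1 (t k n : nat) (Bs : {set {set 'I_n}})
    (hS : steiner_system t k n Bs) :
  (min_sum Bs)%:R <=
    (n%:R * (k%:R - t%:R + 1) + k%:R * (t%:R - 2)) / 2 :> rat.
Proof.
have [[t1 tk kn] _ cardB _] := hS.
pose r := t.-1; have tE : t = r.+1 by rewrite prednK.
have rk : (r < k)%N by rewrite -tE.
have rn : (r < n)%N by apply: leq_trans kn.
pose R : {set 'I_n} := [set i : 'I_n | (i < r)%N].
have sumR (f : nat -> nat) : (\sum_(x in R) f x = \sum_(0 <= i < r) f i)%N.
  rewrite big_mkord (big_ord_widen n f (ltnW rn)).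
  by apply: eq_bigl => x; rewrite inE.
have cardR : #|R| = r.
  by rewrite -sum1_card (sumR (fun=> 1%N)) sum_nat_const_nat subn0 muln1.
have cardRC : (#|~: R| = n - r)%N by rewrite cardsCs setCK card_ord cardR.
pose s0 := block_sum R; pose s1 := block_sum (~: R).
have hs0 : (2 * s0 + r = r ^ 2)%N by rewrite /s0 /block_sum (sumR id) double_sum_nat.
(* [s0 + s1] is the sum of all points, split along [R]. *)
have hs1 : (2 * (s0 + s1) + n = n ^ 2)%N.
  rewrite -[RHS]double_sum_nat big_mkord (bigID (mem R)) /=.
  by congr (2 * (_ + _) + _)%N; apply: eq_bigl => x; rewrite !inE.
pose d := #|[set B in Bs | R \subset B]|.
(* Weight [f = 1]: each of the [d] blocks through [R] covers [k - r] of the [n - r] points outside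
   [R]. *)
have hd : (d * (k - r) = n - r)%N.
  have := sum_derived_blocks (fun=> 1%N) hS cardR.
  rewrite sum1_card cardRC => <-.
  rewrite -sum_nat_const; apply: eq_big => [B|B]; rewrite inE // => /andP[BBs RB].
  by rewrite sum1_card cardsD (setIidPr RB) cardR cardB.
(* Weight [f x = x]: the [d] blocks through [R] each contribute [s0] from [R], and their remainders
   add up to [s1]. *)
have hm : (d * min_sum Bs <= d * s0 + s1)%N.
  rewrite /s1 /block_sum.
  have <- := sum_derived_blocks (@nat_of_ord n) hS cardR.
  rewrite -!sum_nat_const.
  rewrite [X in (_ <= _ + X)%N](eq_bigl (mem [set B in Bs | R \subset B])).
    rewrite -big_split /=; apply: leq_sum => B; rewrite inE => /andP[BBs RB].
    apply: leq_trans (min_sum_le BBs) _.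
    by rewrite /block_sum (big_setID R) /= (setIidPr RB).
  by move=> B; rewrite /= inE.
have d0 : (0 < d)%N by move: rn; rewrite -subn_gt0 -hd muln_gt0 => /andP[].
(* The relations are cast to [rat]; [r < k] and [r < n] ensure that the truncated subtractions
   become true ones. *)
move: hs0 hs1 hd hm d0; rewrite tE -natr1.
move=> /(congr1 (fun x => x%:R : rat)) + /(congr1 (fun x => x%:R : rat)).
move=> + + /(congr1 (fun x => x%:R : rat)).
rewrite -(ler_nat rat) -(ltr_nat rat).
rewrite !(natrD, natrM, natrX) !natrB ?(ltnW rk) ?(ltnW rn) // => h0 h1 hd hm d0.
rewrite -(ler_pM2l d0); apply: le_trans hm _.
(* This is [(n - r)(n + r - 1) / 2] with [n - r] replaced by [d(k - r)], so that [d] factors out. *)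
have -> : s1%:R = d%:R * ((k%:R - r%:R) * (n%:R + r%:R - 1)) / 2 :> rat.
  by rewrite mulrA hd; lra.
have -> : s0%:R = (r%:R ^+ 2 - r%:R) / 2 :> rat by lra.
(* No slack remains: both sides are now equal. *)
by rewrite le_eqVlt; apply/orP; left; apply/eqP; field.
Qed.
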